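(* Let $(T,X)$ be a minimal invertible semiflow on a compact Hausdorff space $X$, with $T$ not necessarily discrete, such that $T$ is either a $C$-semigroup or an amenable semigroup. Then $(T,X)$ is sensitive if and only if its reflection $(X,T)$ is sensitive.
   Context: $X$ is a nonempty compact Hausdorff space with compatible uniformity $\mathscr U_X$ (symmetric entourages), $\delta[x]=\{y:(x,y)\in\delta\}$. A topological semigroup $T$ is a Hausdorff space with jointly continuous associative multiplication and identity $e$. A semiflow $(T,X)$ is a jointly continuous map $T\times X\to X$, $(t,x)\mapsto tx$, with $ex=x$ and $t(sx)=(ts)x$. It is minimal if $Tx=\{tx:t\in T\}$ is dense in $X$ for every $x$; invertible if each $x\mapsto tx$ is a bijection (hence a homeomorphism) of $X$; its reflection $(X,T)$ is then the right action $(x,t)\mapsto xt:=t^{-1}x$. $T$ is a $C$-semigroup if $T\setminus sT$ and $T\setminus Ts$ are relatively compact in $T$ for every $s\in T$. $T$ is amenable if, as a discrete semigroup, every semiflow $(T,Y)$ with phase semigroup $T$ on a nonempty compact Hausdorff space $Y$ admits an invariant Borel probability measure, i.e. a Borel probability measure $\mu$ on $Y$ with $\mu(B)=\mu(t^{-1}B)$ for all $t\in T$ and all Borel sets $B\subseteq Y$, where $t^{-1}B=\{y\in Y: ty\in B\}$. $(T,X)$ is sensitive if there is $\varepsilon\in\mathscr U_X$ such that for all $x\in X$ and $\delta\in\mathscr U_X$ there are $y\in\delta[x]$ and $t\in T$ with $(tx,ty)\notin\varepsilon$. $(X,T)$ is sensitive if the same holds with $(t^{-1}x,t^{-1}y)$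 in place of $(tx,ty)$. *)

(* Defs.v *)
From HB Require Import structures.
From mathcomp Require Import all_boot all_order all_algebra.
From mathcomp Require Import all_classical all_reals all_analysis.

Set Implicit Arguments.
Unset Strict Implicit.
Unset Printing Implicit Defensive.

Local Open Scope classical_set_scope.

HB.mixin Record isTopologicalSemigroup T & Topological T & Monoid T := {
  hausdorff_semigroup : hausdorff_space T;
  mulg_continuous : continuous (fun p : T * T => (p.1 * p.2)%g)
}.

#[short(type="topSemigroupType")]
HB.structure Definition TopologicalSemigroup :=
  {T of Topological T & Monoid T & isTopologicalSemigroup T}.

HB.instance Definition _ (T : monoidType) :=
  Monoid.copy (discrete_topology T) T.

Lemma discrete_hausdorff_semigroup (T : monoidType) :
  hausdorff_space (discrete_topology T).
Proof.
move=> x y /(_ [set x] [set y]) []; [exact: discrete_set1..|].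
by move=> z [-> ->].
Qed.

Lemma discrete_mulg_continuous (T : monoidType) :
  continuous (fun p : discrete_topology T * discrete_topology T =>
    (p.1 * p.2)%g).
Proof.
move=> [x y] A /= /nbhs_singleton Axy.
exists ([set x], [set y]); first by split; exact: discrete_set1.
by move=> [_ _] [/= -> ->].
Qed.

HB.instance Definition _ (T : monoidType) :=
  isTopologicalSemigroup.Build (discrete_topology T)
    (@discrete_hausdorff_semigroup T) (@discrete_mulg_continuous T).

Definition semiflow (T : topSemigroupType) (X : topologicalType)
    (a : T -> X -> X) : Prop :=
  [/\ continuous (fun p : T * X => a p.1 p.2),
      forall x, a 1%g x = x
    & forall t s x, a t (a s x) = a (t * s)%g x].

Definition minimal_semiflow (T : topSemigroupType) (X : topologicalType)
    (a : T -> X -> X) : Prop :=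
  semiflow a /\ forall x, dense [set a t x | t in [set: T]].

Definition invertible (T : topSemigroupType) (X : topologicalType)
    (a : T -> X -> X) : Prop :=
  forall t, bijective (a t).

(* The right action xt := t^-1 x, written as the family of maps x |-> t^-1 x.
   It is meaningful for invertible [a] only: the point y with ty = x then
   exists and is unique, so the default value [x] of [xget] is never used. *)
Definition reflection (T : topSemigroupType) (X : topologicalType)
    (a : T -> X -> X) : T -> X -> X :=
  fun t x => xget x [set y | a t y = x].

Lemma reflectionK (T : topSemigroupType) (X : topologicalType)
    (a : T -> X -> X) (t : T) : invertible a -> cancel (reflection a t) (a t).
Proof.
move=> /(_ t) [b _ bK] x; rewrite /reflection.
by case: xgetP => [//|] /(_ (b x)) /=; rewrite bK.
Qed.

Lemma reflectionKV (T : topSemigroupType) (X : topologicalType)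
    (a : T -> X -> X) (t : T) : invertible a -> cancel (a t) (reflection a t).
Proof.
by move=> ainv x; apply: (bij_inj (ainv t)); rewrite reflectionK.
Qed.

(* [a] need not be a semiflow here, so that [sensitive (reflection a)] is the
   sensitivity of the reflection of [a]. *)
Definition sensitive (T : topSemigroupType) (X : uniformType)
    (a : T -> X -> X) : Prop :=
  exists2 eps : set (X * X), entourage eps &
    forall (x : X) (delta : set (X * X)), entourage delta ->
      exists (y : X) (t : T), delta (x, y) /\ ~ eps (a t x, a t y).

Definition C_semigroup (T : topSemigroupType) : Prop :=
  forall s : T,
    precompact (~` [set (s * t)%g | t in [set: T]]) /\
    precompact (~` [set (t * s)%g | t in [set: T]]).

Definition invariant_measure (R : realType) (T : topSemigroupType)
    (Y : ptopologicalType) (a : T -> Y -> Y)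
    (mu : probability (g_sigma_algebraType (@open Y)) R) : Prop :=
  forall (t : T) (B : set (g_sigma_algebraType (@open Y))),
    measurable B -> mu B = mu (a t @^-1` B).

(* The phase space [Y] is nonempty because a [ptopologicalType] is pointed. *)
Definition amenable (R : realType) (T : topSemigroupType) : Prop :=
  forall (Y : ptopologicalType) (a : discrete_topology T -> Y -> Y),
    compact [set: Y] -> hausdorff_space Y -> semiflow a ->
    exists mu : probability (g_sigma_algebraType (@open Y)) R,
      invariant_measure a mu.

(* Main.v *)
(** Fix an entourage E. If an action f is not sensitive, there is a nonempty
    open set V on which all the maps f t are simultaneously E-small. The point
    is to cover X by finitely many such E-small sets: then, up to E, the
    iterates of a single f s take finitely many values, so two of them are
    uniformly close, so the inverse of f s is uniformly close to an iterate of
    f s. Hence V is also small for the inverse maps, which are therefore not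
    sensitive.

    For the reflection the open sets t^-1 V are small, and cover X by
    minimality. For T itself only the maps f s with s in Tt are under control
    on t^-1 V; when T is a C-semigroup the others lie in a compact set and are
    controlled by joint continuity. When T is amenable, an invariant measure
    gives all translates tV the same positive measure, so a maximal disjoint
    family of them is finite; every translate meets a member of it, and the
    closures of the resulting stars are small and cover X. *)
From HB Require Import structures.
Require Import Defs.
From mathcomp Require Import all_boot all_order all_algebra.
From mathcomp Require Import all_classical all_reals all_analysis.
From mathcomp Require Import zify.

Import Order.TTheory GRing.Theory Num.Theory.

Local Open Scope classical_set_scope.

(** * Entourages and finite covers of compact spaces *)

Lemma symmetric_entourage_split3 (X : uniformType) (E : set (X * X)) :
  entourage E -> exists D : set (X * X),
    [/\ entourage D, forall x y, D (x, y) -> D (y, x)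
      & forall x y z w, D (x, y) -> D (y, z) -> D (z, w) -> E (x, w)].
Proof.
move=> entE; pose F := split_ent (split_ent E).
have entF : entourage F by exact/entourage_split_ent/entourage_split_ent.
exists (F `&` F^-1)%relation; split; first exact: entourage_invI.
  by move=> x y [].
move=> x y z w [xy _] [yz _] [zw _].
have sE : entourage (split_ent E) by exact: entourage_split_ent.
apply: (entourage_split z) => //; first exact: (entourage_split y).
by apply: (entourage_split w) => //; exact: entourage_refl.
Qed.

Lemma compact_finite_nbhs_cover (X : topologicalType) (V : X -> set X) :
  compact [set: X] -> (forall x, nbhs x (V x)) ->
  exists (n : nat) (s : 'I_n -> X), forall y, exists i, V (s i) y.
Proof.
move=> /compact_near_coveringP cX nV.
(* [F] consists of the properties shared by all sequences containing a given one, so near-covering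
   yields one sequence of centres serving every point. *)
pose F : set_system (seq X) :=
  [set A | exists s0 : seq X, forall s, {subset s0 <= s} -> A s].
have FF : Filter F.
  split=> [|A B [s As] [s' Bs']|A B AB [s As]].
  - by exists [::].
  - exists (s ++ s') => u su; split; [apply: As|apply: Bs'] => x xs;
      by apply: su; rewrite mem_cat xs ?orbT.
  - by exists s => u /As/AB.
have [|s0 /(_ s0 (fun=> id)) cov] :=
    cX _ F (fun s y => exists2 x, x \in s & V x y) FF.
  move=> x _; exists (V x, [set s | x \in s]).
    by split => //; exists [:: x] => s; apply; rewrite mem_head.
  by move=> [y s] [/= Vy xs]; exists x.
exists (size s0), (tnth (in_tuple s0)) => y.
have [//|x /(@tnthP _ _ (in_tuple s0))[i ->] Vy] := cov y.
by exists i.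
Qed.

(** * Sets small under a whole family of maps *)

Section Smallness.
Context {T : Type} {X : uniformType}.
Implicit Types (f g : T -> X -> X) (E : set (X * X)) (V : set X).

(** An arbitrary family [f] is allowed, so that both the action and its reflection qualify. *)
Definition orbit_small f E V :=
  forall t x y, V x -> V y -> E (f t x, f t y).

Definition finite_orbit_small_cover f E :=
  exists (n : nat) (P : 'I_n -> set X),
    (forall i, orbit_small f E (P i)) /\ forall x, exists i, P i x.

(** Continuity of each single [f t] is enough, since the nearby point of [V] may depend on [t]. *)
Lemma orbit_small_closure f E D V :
  (forall t, continuous (f t)) -> entourage D ->
  (forall x y, D (x, y) -> D (y, x)) ->
  (forall x y z w, D (x, y) -> D (y, z) -> D (z, w) -> E (x, w)) ->
  orbit_small f D V -> orbit_small f E (closure V).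
Proof.
move=> cf entD Dsym D3 VD t x y clx cly.
have near_pt z : closure V z -> exists2 v, V v & D (f t z, f t v).
  move=> /(_ ((f t) @^-1` xsection D (f t z))) [].
    by apply: cf; exact: nbhs_entourage.
  by move=> v [Vv /xsectionP Dv]; exists v.
have [v Vv xv] := near_pt x clx; have [w Vw yw] := near_pt y cly.
exact: D3 xv (VD t _ _ Vv Vw) (Dsym _ _ yw).
Qed.

Lemma compact_orbit_small_cover f E :
  compact [set: X] ->
  (forall x : X, exists2 V : set X, nbhs x V & orbit_small f E V) ->
  finite_orbit_small_cover f E.
Proof.
move=> cX loc.
have [V VE] : {V : X -> set X &
    forall x, nbhs x (V x) /\ orbit_small f E (V x)}.
  apply: (@choice _ _ (fun x V => nbhs x V /\ orbit_small f E V)) => x.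
  by have [V] := loc x; exists V.
have [n [s cov]] := compact_finite_nbhs_cover X V cX (fun x => (VE x).1).
by exists n, (V \o s); split => // i; exact: (VE _).2.
Qed.

(* By the pigeonhole principle two iterates [f s ^ k] and [f s ^ l], [k < l],
   are close at a representative of each class of the cover, hence uniformly
   close; so the inverse of [f s] is uniformly close to [f s ^ (l - k - 1)]. *)
Lemma inverse_near_iterate f g E D s :
  cancel (g s) (f s) ->
  (forall n, exists t, forall x, f t x = iter n (f s) x) ->
  (forall x y, D (x, y) -> D (y, x)) ->
  (forall x y z w, D (x, y) -> D (y, z) -> D (z, w) -> E (x, w)) ->
  finite_orbit_small_cover f D ->
  exists t, forall x, E (f t x, g s x).
Proof.
move=> gK powf Dsym D3 [n [P [PD cov]]].
have [c Pc] : {c : X -> 'I_n & forall x, P (c x) x}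
  by exact: (@choice _ _ (fun x i => P i x)).
have c_near k x y : c x = c y -> D (iter k (f s) x, iter k (f s) y).
  have [t <- <-] : exists2 t, f t x = iter k (f s) x & f t y = iter k (f s) y.
    by have [t ft] := powf k; exists t.
  by move=> cxy; apply: PD (Pc x) _; rewrite cxy.
(* [r] picks a representative of each class of [c], and is [None] where the class is empty. *)
have [r rc] : {r : 'I_n -> option X &
    forall x, exists2 y, r (c x) = Some y & c y = c x}.
  pose r i := if pselect (exists x, c x = i) is left h
    then Some (projT1 (cid h)) else None.
  exists r => x; rewrite /r; case: pselect => [h|[]]; last by exists x.
  by case: (cid h) => y /= cy; exists y.
(* [pat k] records the classes that the representatives reach after [k] steps; there are finitely
   many patterns. *)
pose pat k : {ffun 'I_n -> option 'I_n} :=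
  [ffun i => omap (fun y => c (iter k (f s) y)) (r i)].
have [k [l [kl kl_pat]]] : exists k l, (k < l)%N /\ pat k = pat l.
  pose h (i : 'I_#|{ffun 'I_n -> option 'I_n}|.+1) := pat i.
  have : ~~ injectiveb h.
    apply/injectiveP => /leq_card; rewrite card_ord ltnn//.
  move=> /injectivePn[i [j ij hij]].
  have [ltij|ltji|/ord_inj ijE] := ltngtP i j; [by exists i, j|by exists j, i|].
  by rewrite ijE eqxx in ij.
have iter_near x : E (iter l (f s) x, iter k (f s) x).
  have [y ry cy] := rc x.
  move: kl_pat => /ffunP/(_ (c x)); rewrite !ffunE ry /= => -[cE].
  apply: D3 (c_near l _ _ (esym cy)) _ (c_near k _ _ cy).
  by apply: (c_near 0%N); rewrite cE.
have [t ft] := powf (l - k).-1; exists t => x.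
have gsK m y : iter m (f s) (iter m (g s) y) = y.
  by elim: m y => // m IH y; rewrite iterSr iterS gK IH.
(* From this point [k] steps of [f s] lead to [g s x], and [l] steps to the iterate of order
   [l - k - 1] at [x]. *)
have := iter_near (iter k.+1 (g s) x).
rewrite [X in E (_, X)](_ : _ = g s x); last by rewrite iterSr gsK.
have -> : l = ((l - k).-1 + k.+1)%N by lia.
by rewrite iterD gsK -ft.
Qed.

End Smallness.

(** * From insensitivity to small open sets and to inverse maps *)

Section Sensitivity.
Context {T : topSemigroupType} {X : uniformType}.
Implicit Types (f g : T -> X -> X) (E : set (X * X)) (V : set X).

(** Insensitivity at a third of [E] gives a ball whose points stay close to its centre; two of them
    are compared through the centre. *)
Lemma insensitive_orbit_small f E : ~ sensitive f -> entourage E ->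
  exists V, [/\ open V, V !=set0 & orbit_small f E V].
Proof.
move=> nsf /symmetric_entourage_split3 [D [entD Dsym D3]].
have [x [delta [entdelta xD]]] : exists (x : X) (delta : set (X * X)),
    entourage delta /\ forall y t, delta (x, y) -> D (f t x, f t y).
  apply: contrapT => nex; apply: nsf; exists D => // x delta entdelta.
  apply: contrapT => nyt; apply: nex; exists x, delta; split => // y t xy.
  by apply: contrapT => nD; apply: nyt; exists y, t.
exists (xsection delta x)^°; split; first exact: open_interior.
  by exists x; exact: nbhs_entourage.
move=> t y z /interior_subset/xsectionP xy /interior_subset/xsectionP xz.
by apply: D3 (Dsym _ _ (xD y t xy)) (xD z t xz) _; exact: entourage_refl.
Qed.

(** Every [g s] is uniformly close to some [f t], and all the [f t] are small on one open set, so
    all the [g s] are small there too. *)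
Lemma insensitive_inverse f g :
  (forall s, cancel (g s) (f s)) ->
  (forall s n, exists t, forall x, f t x = iter n (f s) x) ->
  (forall E, entourage E -> finite_orbit_small_cover f E) ->
  ~ sensitive f -> ~ sensitive g.
Proof.
move=> gK powf cov nsf [E entE].
have [D [entD Dsym D3]] := symmetric_entourage_split3 _ E entE.
have [C [entC Csym C3]] := symmetric_entourage_split3 _ D entD.
have [V [oV [x Vx] VD]] := insensitive_orbit_small _ _ nsf entD.
have [delta entdelta deltaV] :
    exists2 delta, entourage delta & xsection delta x `<=` V.
  by move: (open_nbhs_nbhs (conj oV Vx)); rewrite -nbhs_entourageE.
move=> /(_ x delta entdelta)[y [s [xy]]]; apply.
have [t ft] :=
  inverse_near_iterate _ _ _ _ s (gK s) (powf s) Csym C3 (cov _ entC).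
apply: D3 (Dsym _ _ (ft x)) (VD t _ _ Vx _) (ft y).
by apply: deltaV; exact/xsectionP.
Qed.

(** * Orbit-small covers for minimal semiflows *)

Section Minimal.
Context {a : T -> X -> X}.
Hypotheses (cX : compact [set: X]) (mina : minimal_semiflow a).

Let a_comp t s x : a t (a s x) = a (t * s)%g x.
Proof. by case: mina => -[]. Qed.

Let a_cont2 : continuous (fun p : T * X => a p.1 p.2).
Proof. by case: mina => -[]. Qed.

Lemma semiflow_continuous t : continuous (a t).
Proof.
move=> x; apply: (@continuous_comp _ _ _
  (fun y => (t, y)) (fun p : T * X => a p.1 p.2)).
  by apply: cvg_pair; [exact: cvg_cst|exact: cvg_id].
exact: a_cont2.
Qed.

Lemma minimal_hits_open V x : open V -> V !=set0 -> exists t, V (a t x).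
Proof.
move=> oV V0; have [y [Vy [t _ ty]]] := mina.2 x V V0 oV.
by exists t; rewrite ty.
Qed.

Lemma open_preimage V t : open V -> open (a t @^-1` V).
Proof. by move: V; apply/continuousP; exact: semiflow_continuous. Qed.

Lemma semiflow_iter s n : exists t, forall x, a t x = iter n (a s) x.
Proof.
elim: n => [|n [t ft]]; first by exists 1%g => x; case: mina => -[].
by exists (s * t)%g => x; rewrite -a_comp ft.
Qed.

Lemma reflection_orbit_small_cover E : invertible a ->
  ~ sensitive (reflection a) -> entourage E ->
  finite_orbit_small_cover (reflection a) E.
Proof.
move=> ainv nsr entE.
have [V [oV V0 VE]] := insensitive_orbit_small _ _ nsr entE.
apply: compact_orbit_small_cover => // x.
have [t Vt] := minimal_hits_open V x oV V0.
exists (a t @^-1` V).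
  by apply: open_nbhs_nbhs; split => //; exact: open_preimage.
(* Since s^-1 = (ts)^-1 t, every inverse map on t^-1 V factors through [V]. *)
have ref_comp s y : reflection a s y = reflection a (t * s)%g (a t y).
  apply: (bij_inj (ainv (t * s)%g)).
  by rewrite reflectionK// -a_comp reflectionK.
by move=> s y z Vy Vz; rewrite (ref_comp s y) (ref_comp s z); exact: VE.
Qed.

Lemma C_semigroup_orbit_small_cover E : C_semigroup T ->
  ~ sensitive a -> entourage E -> finite_orbit_small_cover a E.
Proof.
move=> CT nsa /symmetric_entourage_split3 [D [entD Dsym D3]].
have [C [entC Csym C3]] := symmetric_entourage_split3 _ D entD.
have [V [oV V0 VE]] := insensitive_orbit_small _ _ nsa entD.
have DE x y : D (x, y) -> E (x, y).
  by move=> xy; apply: D3 xy _ _; exact: entourage_refl.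
apply: compact_orbit_small_cover => // x.
have [t Vt] := minimal_hits_open V x oV V0.
have := (CT t).2; rewrite precompactE => /compact_near_coveringP/(_ X (nbhs x)).
set K := closure _ => near_cov.
have Kx : \forall y \near x, K `<=` (fun s => D (a s x, a s y)).
  apply: near_cov => s _.
  (* Both [a p.1 p.2] and [a p.1 x] move with [p], so each is compared with the fixed point
     [a s x]. *)
  have near_a : \forall p \near (s, x), C (a s x, a p.1 p.2).
    have /filterS : nbhs (s, x) [set p | xsection C (a s x) (a p.1 p.2)].
      by apply: (a_cont2 (s, x)); exact: nbhs_entourage.
    by apply => p /= /xsectionP.
  have near_x : \forall p \near (s, x), C (a s x, a p.1 x).
    have : continuous (fun p : T * X => a p.1 x).
      move=> p; apply: (@continuous_comp _ _ _
        (fun p : T * X => (p.1, x)) (fun p : T * X => a p.1 p.2)).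
        by apply: cvg_pair; [exact: cvg_fst|exact: cvg_cst].
      exact: a_cont2.
    move=> cont1.
    have /filterS : nbhs (s, x) [set p | xsection C (a s x) (a p.1 x)].
      by apply: (cont1 (s, x)); exact: nbhs_entourage.
    by apply => p /= /xsectionP.
  apply: filterS2 near_a near_x => p pa px /=.
  by apply: C3 (Csym _ _ px) pa _; exact: entourage_refl.
exists ([set y | K `<=` (fun s => D (a s x, a s y))] `&` (a t @^-1` V)).
  apply: filterI => //.
  by apply: open_nbhs_nbhs; split => //; exact: open_preimage.
move=> s y z [Ky Vy] [Kz Vz].
have [[r _ <-]|nrs] := pselect ([set (r * t)%g | r in [set: T]] s).
  by rewrite -!a_comp; apply/DE/VE.
have Ks : K s by exact: subset_closure.
by apply: D3 (Dsym _ _ (Ky s Ks)) (Kz s Ks) _; exact: entourage_refl.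
Qed.

(** By minimality and compactness finitely many preimages of [V] cover the space. By invariance all
    have the measure of [V], which cannot be 0 as the total is 1. *)
Lemma invariant_measure_gt0 (R : realType) (x0 : X)
    (Y := HB.pack_for ptopologicalType X (isPointed.Build X x0))
    (mu : probability (g_sigma_algebraType (@open Y)) R) V :
  @invariant_measure R T Y a mu -> open V -> V !=set0 -> (0 < mu V)%E.
Proof.
move=> inv oV V0; rewrite lt0e measure_ge0 andbT; apply/eqP => muV0.
have [t Vt] : {t : X -> T & forall x, V (a (t x) x)}.
  by apply: (@choice _ _ (fun x t => V (a t x))) => x; exact: minimal_hits_open.
have [x|n [s cov]] := compact_finite_nbhs_cover X (fun x => a (t x) @^-1` V) cX.
  by apply: open_nbhs_nbhs; split; [apply: open_preimage|apply: Vt].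
have mV : measurable (V : set (g_sigma_algebraType (@open Y))).
  exact: sub_sigma_algebra.
have : (mu [set: _] <= \sum_(i \in [set: 'I_n]) mu (a (t (s i)) @^-1` V))%E.
  apply: content_sub_fsum => //; first exact: finite_finset.
  - move=> i _; apply: sub_sigma_algebra; exact: open_preimage.
  - by move=> y _; have [i] := cov y; exists i.
rewrite probability_setT fsbig1; last by move=> i _; rewrite -inv.
by rewrite lee_fin ler10.
Qed.

(** Translates all have measure [mu V > 0], so at most [1 / mu V] of them are disjoint. *)
Lemma amenable_packing (R : realType) V :
  hausdorff_space X -> invertible a -> amenable R T -> open V -> V !=set0 ->
  exists N, forall n (t : 'I_n -> T),
    trivIset [set: 'I_n] (fun i => a (t i) @` V) -> (n <= N)%N.
Proof.
move=> hX ainv amT oV V0; have [x0 Vx0] := V0.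
pose Y := HB.pack_for ptopologicalType X (isPointed.Build X x0).
(* For discrete [T], joint continuity reduces to continuity of each [a t]. *)
have discrete_a : @semiflow (discrete_topology T) Y a.
  case: mina => -[_ a1 ac] _; split => // -[t x] A /= nA.
  exists ([set t], a t @^-1` A); last by move=> [_ y] [/= -> Ay].
  split; first exact: discrete_set1.
  exact: semiflow_continuous nA.
have [mu inv] := amT Y a cX hX discrete_a.
have muV : (0 < mu V)%E := invariant_measure_gt0 R x0 mu V inv oV V0.
have mV : measurable (V : set (g_sigma_algebraType (@open Y))).
  exact: sub_sigma_algebra.
have mtV t : measurable (a t @` V : set (g_sigma_algebraType (@open Y))).
  (* Translates are open, hence Borel: the bijection [a t] maps the compact complement of [V] onto a
     compact, so closed, set. *)
  apply: sub_sigma_algebra; rewrite -[X in open X]setCK; apply: closed_openC.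
  have -> : ~` (a t @` V) = a t @` (~` V).
    rewrite eqEsubset.
    split => [y nVy|_ [y nVy <-] [z Vz /(bij_inj (ainv t)) zy]].
      exists (reflection a t y); last by rewrite reflectionK.
      move=> Vy; apply: nVy; exists (reflection a t y) => //.
      by rewrite reflectionK.
    by apply: nVy; rewrite -zy.
  apply: compact_closed => //; apply: continuous_compact.
    by apply: continuous_subspaceT; exact: semiflow_continuous.
  by apply: subclosed_compact cX _ => //; exact: open_closedC.
have mutV t : mu (a t @` V) = mu V.
  rewrite (inv t)//; congr (mu _); rewrite eqEsubset; split => [y [z Vz]|y Vy].
    by move=> /(bij_inj (ainv t)) <-.
  by exists y.
have fV : mu V \is a fin_num by exact: fin_num_measure.
have V_gt0 : (0 < fine (mu V))%R by rewrite -lte_fin fineK.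
exists (Num.bound (fine (mu V))^-1) => n t tI.
have mU : measurable (\big[setU/set0]_(i < n) (a (t i) @` V) :
    set (g_sigma_algebraType (@open Y))).
  by apply: bigsetU_measurable => i _; exact: mtV.
have := probability_le1 mu mU; rewrite measure_bigsetU_ord//.
rewrite (eq_bigr (fun=> (fine (mu V))%:E)); last first.
  by move=> i _; rewrite fineK//; exact: mutV.
rewrite sumEFin sumr_const card_ord lee_fin.
rewrite -mulr_natl -ler_pdivlMr// div1r => nV.
have := @archi_boundP _ (fine (mu V))^-1.
rewrite invr_ge0 ltW// => /(_ isT) /(le_lt_trans nV).
by rewrite ltr_nat => /ltnW.
Qed.

Lemma amenable_orbit_small_cover (R : realType) E :
  hausdorff_space X -> invertible a -> amenable R T ->
  ~ sensitive a -> entourage E -> finite_orbit_small_cover a E.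
Proof.
move=> hX ainv amT nsa /symmetric_entourage_split3 [D [entD Dsym D3]].
have [C [entC Csym C3]] := symmetric_entourage_split3 _ D entD.
have [V [oV V0 VC]] := insensitive_orbit_small _ _ nsa entC.
have [N packN] := amenable_packing R V hX ainv amT oV V0.
pose disjoint_translates n := `[< exists t : 'I_n -> T,
  trivIset [set: 'I_n] (fun i => a (t i) @` V) >].
have ex0 : exists n, disjoint_translates n.
  by exists 0%N; apply/asboolP; exists (fun=> 1%g) => -[].
have leN n : disjoint_translates n -> (n <= N)%N.
  by move=> /asboolP[t]; exact: packN.
have [n /asboolP[t tI] nmax] := ex_maxnP ex0 leN.
have meet s : exists i, a s @` V `&` a (t i) @` V !=set0.
  apply: contrapT => nmeet; suff : disjoint_translates n.+1.
    by move=> /nmax; rewrite ltnn.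
  apply/asboolP; exists (fun i => if unlift ord0 i is Some j then t j else s).
  move=> i j _ _; case: unliftP => [k ->|->]; case: unliftP => [l ->|->] //=.
  - by move=> /(tI k l I I) ->.
  - by rewrite setIC => kl; exfalso; apply: nmeet; exists k.
  - by move=> kl; exfalso; apply: nmeet; exists l.
pose star i := [set z | exists s,
  (a s @` V) z /\ a s @` V `&` a (t i) @` V !=set0].
have translate_small s : orbit_small a C (a s @` V).
  by move=> r _ _ [y Vy <-] [z Vz <-]; rewrite !a_comp; exact: VC.
have star_small i : orbit_small a D (star i).
  move=> r y z [s [sy [y' [sy' ty']]]] [u [uz [z' [uz' tz']]]].
  apply: C3 (translate_small s r _ _ sy sy') _ (translate_small u r _ _ uz' uz).
  exact: (translate_small (t i) r).
exists n, (fun i => closure (star i)); split.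
  move=> i; apply: orbit_small_closure entD Dsym D3 _ => //.
  exact: semiflow_continuous.
(* Were [z] outside all closed stars, a neighbourhood of it would miss every star; yet it contains a
   point of the orbit of [v], which lies in a star. *)
move=> z; apply: contrapT => nz; have [v Vv] := V0.
have : \forall y \near z, forall i, ~ star i y.
  apply: filter_forall => i; apply: contrapT => ny; apply: nz; exists i => B nB.
  apply: contrapT => nSB; apply: ny; apply: filterS nB => y By sy.
  by apply: nSB; exists y.
rewrite /prop_near1 nbhsE => -[U [oU Uz] Ustar].
have [s Us] := minimal_hits_open U v oU (ex_intro _ z Uz).
have [i si] := meet s.
by apply: (Ustar _ Us i); exists s; split => //; exists v.
Qed.

End Minimal.
End Sensitivity.

Theorem corollary7p6 (R : realType) (T : topSemigroupType) (X : uniformType)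
    (a : T -> X -> X) :
  [set: X] !=set0 -> compact [set: X] -> hausdorff_space X ->
  minimal_semiflow a -> invertible a ->
  C_semigroup T \/ amenable R T ->
  sensitive a <-> sensitive (reflection a).
Proof.
move=> _ cX hX mina ainv CT_amT.
have aK t : cancel (a t) (reflection a t) := reflectionKV t ainv.
have raK t : cancel (reflection a t) (a t) := reflectionK t ainv.
split; apply: contraPP => nsens; apply: insensitive_inverse (nsens) => //.
(* The [n]-th iterate of the inverse of [a s] is the inverse of its [n]-th iterate [a t]. *)
- move=> s n; have [t ft] := semiflow_iter mina s n; exists t => x.
  apply: (bij_inj (ainv t)); rewrite raK ft.
  by elim: n x {ft} => // n IH x; rewrite iterSr iterS raK -IH.
- by move=> E; exact: reflection_orbit_small_cover.
- exact: semiflow_iter.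
- move=> E entE; case: CT_amT => [CT|amT].
    exact: C_semigroup_orbit_small_cover.
  exact: (amenable_orbit_small_cover cX mina R).
Qed.
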